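(* There exists a finitely generated periodic just infinite group $Q$ such that: (1) the orders of elements of $Q$ are square free; (2) every section of $Q$ is residually finite; in particular, $Q$ is residually finite; (3) if $S$ is a finite section of $Q$, then $S$ is solvable and all Sylow subgroups of $S$ are abelian; in particular, every nilpotent section of $Q$ is abelian.
   Context: A group $S$ is a section of a group $Q$ if $S$ is a quotient group of a subgroup of $Q$. An infinite group is called just infinite if all its proper quotients (quotients by non-trivial normal subgroups) are finite. A group is periodic if every element has finite order. *)

(* Defs.v *)
(* Mathematical Components; arbitrary (possibly infinite) groups are the
   groupType structure, finite ones finGroupType. *)
From HB Require Import structures.
From mathcomp Require Import all_boot all_fingroup all_solvable.
From mathcomp Require Import boolp classical_sets functions cardinality.

Set Implicit Arguments.
Unset Strict Implicit.
Unset Printing Implicit Defensive.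

Local Open Scope quotient_scope.
Local Open Scope group_scope.

(* Subgroups are boolean predicates {pred G}: by excluded middle (boolp) every
   subset of G is of this form. *)
HB.mixin Record isConjClosed (G : groupType) (S : {pred G}) := {
  gpredJ_subproof : forall x y : G, x \in S -> x ^ y \in S
}.

#[short(type="normalClosed")]
HB.structure Definition NormalClosed (G : groupType) :=
  {S of isConjClosed G S & GroupClosed G S}.

Section Quotient.
Variables (G : groupType) (N : normalClosed G).
Implicit Types x y z : G.

Definition coset_rel x y := x^-1 * y \in N.

Lemma coset_rel_is_equiv : equiv_class_of coset_rel.
Proof.
split=> [x|x y|y x z]; rewrite /coset_rel.
- by rewrite mulVg gpred1.
- by rewrite -[in RHS]gpredV invgM invgK.
- by move=> Nxy Nyz; rewrite -(mulKVg y z) mulgA gpredM.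
Qed.

Canonical coset_equiv := EquivRelPack coset_rel_is_equiv.

Definition quot := {eq_quot coset_equiv}.

HB.instance Definition _ := Choice.on quot.
HB.instance Definition _ := EqQuotient.on quot.

Lemma quot_eqE x y : (\pi_quot x == \pi_quot y) = (x^-1 * y \in N).
Proof. by rewrite piE. Qed.

(* repr and \pi_ also have homonyms in fingroup and prime. *)
Local Notation rep := (@generic_quotient.repr _ quot).
Local Notation cst := (\pi_quot).

Definition quot_mul (a b : quot) : quot := cst (rep a * rep b).
Definition quot_inv (a : quot) : quot := cst (rep a)^-1.
Definition quot_one : quot := cst 1.

Lemma quot_mulE x y : quot_mul (cst x) (cst y) = cst (x * y).
Proof.
apply/eqP; rewrite quot_eqE.
have : cst (rep (cst x)) == cst x by rewrite reprK.
have : cst (rep (cst y)) == cst y by rewrite reprK.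
rewrite !quot_eqE.
move: (rep (cst x)) => x'.
move: (rep (cst y)) => y' Ny Nx.
have -> : (x' * y')^-1 * (x * y) = (x'^-1 * x) ^ y' * (y'^-1 * y).
  by rewrite conjgE invgM !mulgA mulgK.
by rewrite gpredM // gpredJ_subproof.
Qed.

Lemma quot_invE x : quot_inv (cst x) = cst x^-1.
Proof.
apply/eqP; rewrite quot_eqE.
have : cst (rep (cst x)) == cst x by rewrite reprK.
rewrite quot_eqE; move: (rep _) => x' Nx.
have -> : x'^-1^-1 * x^-1 = ((x'^-1 * x) ^ x'^-1)^-1.
  by rewrite conjgE -mulgA mulKg invgM.
by rewrite gpredV gpredJ_subproof.
Qed.

Lemma quot_mulA : associative quot_mul.
Proof.
elim/quotW=> x; elim/quotW=> y; elim/quotW=> z.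
by rewrite (quot_mulE y z) (quot_mulE x y) !quot_mulE mulgA.
Qed.

Lemma quot_mul1g : left_id quot_one quot_mul.
Proof. by elim/quotW=> x; rewrite quot_mulE mul1g. Qed.

Lemma quot_mulg1 : right_id quot_one quot_mul.
Proof. by elim/quotW=> x; rewrite quot_mulE mulg1. Qed.

Lemma quot_mulVg : left_inverse quot_one quot_inv quot_mul.
Proof. by elim/quotW=> x; rewrite quot_invE quot_mulE mulVg. Qed.

Lemma quot_mulgV : right_inverse quot_one quot_inv quot_mul.
Proof. by elim/quotW=> x; rewrite quot_invE quot_mulE mulgV. Qed.

HB.instance Definition _ := isGroup.Build quot
  quot_mulA quot_mul1g quot_mulg1 quot_mulVg quot_mulgV.

Lemma quot_piM : {morph (cst : G -> quot) : x y / x * y}.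
Proof. by move=> x y; symmetry; exact: quot_mulE. Qed.

Lemma quot_pi_eq1 x : (cst x == 1 :> quot) = (x \in N).
Proof. by rewrite eq_sym [LHS]quot_eqE invg1 mul1g. Qed.

End Quotient.

Definition isomorphic (G H : groupType) : Prop :=
  exists f : {multiplicative G -> H}, bijective f.

Definition is_section (Q S : groupType) : Prop :=
  exists (P : {pred Q}) (H : SubGroup.type P) (N : normalClosed H),
    isomorphic (quot N) S.

Definition finite_group (G : groupType) : Prop := finite_set (@setT G).

Definition just_infinite (G : groupType) : Prop :=
  ~ finite_group G /\
  forall N : normalClosed G,
    (exists2 x, x \in N & x != 1) -> finite_group (quot N).

Definition subgroup_generated (G : groupType) (A : set G) : set G :=
  smallest (fun K : set G => group_closed [in K]) A.

Definition finitely_generated (G : groupType) : Prop :=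
  exists s : seq G, subgroup_generated [set` s]%classic = setT.

Definition is_order (G : groupType) (x : G) (n : nat) : Prop :=
  [/\ (0 < n)%N, x ^+ n = 1
    & forall m : nat, (0 < m)%N -> x ^+ m = 1 -> (n <= m)%N].

Definition periodic (G : groupType) : Prop :=
  forall x : G, exists n : nat, is_order x n.

Definition square_free (n : nat) : Prop :=
  forall d : nat, (d ^ 2 %| n)%N -> d = 1%N.

Definition residually_finite (G : groupType) : Prop :=
  forall x : G, x != 1 ->
    exists (F : finGroupType) (f : {multiplicative G -> F}), f x != 1.

(* The library's nilpotent, abelian and lower central series are only for
   subsets of a finGroupType. *)
Fixpoint lower_central (G : groupType) (n : nat) : set G :=
  if n is m.+1 then
    subgroup_generated [set z | exists2 x, @lower_central G m x &
                       exists y : G, z = [~ x, y]]%classic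
  else setT.

Definition nilpotent_group (G : groupType) : Prop :=
  exists n : nat, @lower_central G n = [set 1]%classic.

Definition abelian_group (G : groupType) : Prop :=
  forall x y : G, commute x y.

(* Main.v *)
(* The group is a residually finite limit of finite groups G_0, G_1, ... marked by
   two generators, where the kernel of G_(k+1) -> G_k is elementary abelian for
   the k-th prime. The step is a covering of the Cayley graph of G_k: labelling its
   2 |G_k| edges by F_p makes the positive words act on G_k x F_p. If g has order n
   in G_k, asking that g^n acts trivially costs |G_k| / n linear conditions on the
   labels, while the labels that yield no new element are gradients of functions
   on G_k and form a space of dimension at most |G_k|. So finitely many relators of
   orders n_i can be imposed while the group still grows, provided the sum of the
   1 / n_i is less than 1. The i-th word is frozen as soon as its order reaches
   2^(i+2); a word that never gets there has bounded order anyway, so the limit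
   is an infinite periodic group.

   A tower with distinct primes passes to subgroups, and to quotients because an
   element congruent modulo the kernel to elements arbitrarily deep in the tower
   has, by coprimality, to lie in the kernel; hence it passes to all sections. A
   just infinite quotient exists by Zorn's lemma. *)
Require Import Defs.
From HB Require Import structures.
From mathcomp Require Import all_boot all_fingroup all_algebra all_solvable zify.
From mathcomp Require Import boolp classical_sets cardinality.

Set Implicit Arguments.
Unset Strict Implicit.
Unset Printing Implicit Defensive.

Local Open Scope quotient_scope.
Local Open Scope group_scope.

(** * Towers with elementary abelian layers for distinct primes *)

Fixpoint prime_seq (n : nat) : nat :=
  if n is m.+1 then s2val (prime_above (prime_seq m)) else 2.

Lemma prime_prime_seq n : prime (prime_seq n).
Proof. by case: n => //= n; case: (prime_above _). Qed.

Lemma prime_seq_ltS n : (prime_seq n < prime_seq n.+1)%N.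
Proof. by rewrite /=; case: (prime_above _). Qed.

Lemma prime_seq_inj : injective prime_seq.
Proof.
have lt_mono := homo_ltn ltn_trans prime_seq_ltS.
move=> m n eq_mn; case: (ltngtP m n) => // /lt_mono; by rewrite eq_mn ltnn.
Qed.

Lemma prime_seq_gt n : (n < prime_seq n)%N.
Proof. by elim: n => // n IHn; apply: leq_ltn_trans (prime_seq_ltS n). Qed.

Lemma coprime_prime_seq n i : (0 < n <= i)%N -> coprime n (prime_seq i).
Proof.
move=> /andP[n_gt0 le_ni]; rewrite coprime_sym prime_coprime ?prime_prime_seq //.
apply: contraL (leq_ltn_trans le_ni (prime_seq_gt i)) => /(dvdn_leq n_gt0).
by rewrite leqNgt.
Qed.

(** * Homomorphisms and normal subgroups *)

Section Morphism.
Variables (G H : groupType) (f : G -> H).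
Hypothesis fM : {morph f : x y / x * y}.

Lemma morph_mul1 : f 1 = 1.
Proof. by apply: (mulgI (f 1)); rewrite -fM !mulg1. Qed.

Lemma morph_mulV : {morph f : x / x^-1}.
Proof. by move=> x; apply: (mulgI (f x)); rewrite -fM !mulgV morph_mul1. Qed.

Lemma morph_mulX n : {morph f : x / x ^+ n}.
Proof. by move=> x; elim: n => [|n IHn]; rewrite ?morph_mul1 // !expgS fM IHn. Qed.

Lemma morph_mulJ : {morph f : x y / x ^ y}.
Proof. by move=> x y; rewrite !conjgE !fM morph_mulV. Qed.

Lemma morph_mulR : {morph f : x y / [~ x, y]}.
Proof. by move=> x y; rewrite /commg fM morph_mulV morph_mulJ. Qed.

End Morphism.

Record normal_subgroup (G : groupType) (N : set G) : Prop := NormalSubgroup {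
  nsub1 : N 1;
  nsubFl : forall x y, N x -> N y -> N (x^-1 * y);
  nsubJ : forall x y, N x -> N (x ^ y)
}.

Section NormalSubgroup.
Variables (G : groupType) (N : set G) (nN : normal_subgroup N).

Lemma nsubV x : N x -> N x^-1.
Proof. by move=> Nx; rewrite -[x^-1]mulg1; apply: (nsubFl nN Nx (nsub1 nN)). Qed.

Lemma nsubM x y : N x -> N y -> N (x * y).
Proof. by move=> Nx Ny; rewrite -[x]invgK; apply: (nsubFl nN (nsubV Nx)). Qed.

Lemma nsubX x n : N x -> N (x ^+ n).
Proof.
by move=> Nx; elim: n => [|n IHn]; [apply: (nsub1 nN) | rewrite expgS; apply: nsubM].
Qed.

(** By Bezout, [x] is a product of powers of [x ^+ m] and [x ^+ n]. *)
Lemma nsub_coprime x m n : coprime m n -> N (x ^+ m) -> N (x ^+ n) -> N x.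
Proof.
case: (posnP m) => [->|m_gt0].
  by rewrite /coprime gcd0n => /eqP->.
case/(coprimeP _ m_gt0) => -[u v] /= uv1 Nm Nn.
have /esym eq_um: (u * m = v * n + 1)%N.
  by rewrite -uv1 subnKC // ltnW // -subn_gt0 uv1.
have -> : x = (x ^+ n ^+ v)^-1 * x ^+ m ^+ u.
  by rewrite -!expgnA mulnC [(m * u)%N]mulnC -eq_um expgnDr mulKg.
by apply: (nsubFl nN); apply: nsubX.
Qed.

Definition normal_pred : {pred G} := [pred x | `[< N x >]].

Fact normal_pred_mul : mulg_closed normal_pred.
Proof. by move=> x y /asboolP Nx /asboolP Ny; apply/asboolP/nsubM. Qed.
Fact normal_pred1 : 1 \in normal_pred.
Proof. exact/asboolP/(nsub1 nN). Qed.
Fact normal_predV : invg_closed normal_pred.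
Proof. by move=> x /asboolP Nx; apply/asboolP/nsubV. Qed.
Fact normal_predJ (x y : G) : x \in normal_pred -> x ^ y \in normal_pred.
Proof. by move=> /asboolP Nx; apply/asboolP/(nsubJ nN). Qed.

End NormalSubgroup.

Lemma normal_closedP (G : groupType) (N : set G) :
  normal_subgroup N -> exists M : normalClosed G, forall x, (x \in M) = `[< N x >].
Proof.
move=> nN.
pose mM := isMulClosed.Build G (normal_pred N) (normal_pred_mul nN).
pose m1 := isMul1Closed.Build G (normal_pred N) (normal_pred1 nN).
pose mV := isInvClosed.Build G (normal_pred N) (normal_predV nN).
pose mJ := isConjClosed.Build G (normal_pred N) (normal_predJ nN).
pose M : normalClosed G := HB.pack (normal_pred N) mM m1 mV mJ.
by exists M.
Qed.

Lemma normalClosed_subgroup (G : groupType) (N : normalClosed G) :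
  normal_subgroup (fun x => x \in N).
Proof.
split=> [|x y Nx Ny|x y Nx]; first exact: gpred1.
  by rewrite gpredM ?gpredV.
exact: gpredJ_subproof.
Qed.

(** * Towers and the orders of elements *)

Definition torsion (G : groupType) :=
  forall x : G, exists2 n, (0 < n)%N & x ^+ n = 1.

(** [towerX] and [towerR] make [N i / N i.+1] elementary abelian for the [i]-th prime; [tower_index]
    expresses finite index by a map to a finite type that separates cosets. *)
Record is_tower (G : groupType) (N : nat -> set G) : Prop := IsTower {
  tower_normal : forall i, normal_subgroup (N i);
  tower0 : forall x, N 0 x;
  towerS : forall i x, N i.+1 x -> N i x;
  towerX : forall i x, N i x -> N i.+1 (x ^+ prime_seq i);
  towerR : forall i x y, N i x -> N i y -> N i.+1 [~ x, y];
  tower_index : forall i, exists (F : finType) (f : G -> F),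
    forall x y, f x = f y -> N i (x^-1 * y);
  tower_cap : forall x, (forall i, N i x) -> x = 1
}.

Definition towered (G : groupType) :=
  torsion G /\ exists N : nat -> set G, is_tower N.

Section Tower.
Variables (G : groupType) (N : nat -> set G) (tN : is_tower N).

Lemma tower_sub i j x : (i <= j)%N -> N j x -> N i x.
Proof.
move/subnK<-; elim: (j - i)%N => // k IHk /=.
by rewrite addSn => /(towerS tN)/IHk.
Qed.

(** Modulo [N i.+1], both of the coprime numbers [n] and [prime_seq i] kill [x]. *)
Lemma tower_coprime_step i x n :
  coprime n (prime_seq i) -> x ^+ n = 1 -> N i x -> N i.+1 x.
Proof.
move=> co_n xn Nx.
apply: (nsub_coprime (tower_normal tN i.+1) co_n _ (towerX tN Nx)).
by rewrite xn; apply: (nsub1 (tower_normal tN _)).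
Qed.

(** No layer from [i] on can stop [x], so it sinks into the trivial intersection. *)
Lemma tower_coprime_eq1 i x n :
    (forall j, (i <= j)%N -> coprime n (prime_seq j)) -> x ^+ n = 1 ->
  N i x -> x = 1.
Proof.
move=> co_n xn Nx; apply: (tower_cap tN) => j.
have [le_ji|/ltnW/subnK<-] := leqP j i; first exact: tower_sub Nx.
elim: (j - i)%N => // k IHk; rewrite addSn; apply: tower_coprime_step xn IHk.
exact/co_n/leq_addl.
Qed.

Lemma tower_prime_reach i x n :
    (forall j, (j < i)%N -> coprime n (prime_seq j)) -> x ^+ n = 1 -> N i x.
Proof.
move=> co_n xn; elim: i co_n => [|i IHi] co_n; first exact: (tower0 tN).
apply: tower_coprime_step (co_n i (ltnSn i)) xn (IHi _) => j /ltnW.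
exact: co_n.
Qed.

End Tower.

Lemma prime_seq_coprime q : prime q ->
  (forall j, coprime q (prime_seq j)) \/
  (exists2 i, q = prime_seq i & forall j, j != i -> coprime q (prime_seq j)).
Proof.
move=> q_pr.
have [[i ->]|no_i] := pselect (exists i, q = prime_seq i); [right|left].
  exists i => // j neq_ji; rewrite prime_coprime ?prime_prime_seq //.
  by rewrite dvdn_prime2 ?prime_prime_seq // (inj_eq prime_seq_inj) eq_sym.
move=> j; rewrite prime_coprime // dvdn_prime2 ?prime_prime_seq //.
by apply/eqP => q_j; case: no_i; exists j.
Qed.

(** If [q] is the prime of layer [i], both elements reach [N i], their commutator falls into
    [N i.+1], and no nontrivial [q]-element lies there. If [q] belongs to no layer, [x] is already
    1. *)
Lemma tower_primary_commute (G : groupType) (N : nat -> set G) q a b c (x y : G) :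
    is_tower N -> prime q -> x ^+ (q ^ a) = 1 -> y ^+ (q ^ b) = 1 ->
  [~ x, y] ^+ (q ^ c) = 1 -> commute x y.
Proof.
move=> tN q_pr xq yq xyq; have [co_q|[i eq_qi co_q]] := prime_seq_coprime q_pr.
  have -> : x = 1; last exact/commute_sym/commute1.
  apply: (tower_coprime_eq1 tN (i := 0) _ xq) (tower0 tN x) => j _.
  exact: coprimeXl.
have Ni z n : z ^+ (q ^ n) = 1 -> N i z.
  apply: tower_prime_reach => // j lt_ji; apply/coprimeXl/co_q.
  by rewrite neq_ltn lt_ji.
apply/commgP/eqP.
apply: (tower_coprime_eq1 tN (i := i.+1) _ xyq (towerR tN (Ni _ _ xq) (Ni _ _ yq))).
by move=> j lt_ij; apply/coprimeXl/co_q; rewrite neq_ltn lt_ij orbT.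
Qed.

(** If a prime [q] has its square dividing [n], then [x ^+ (n / q ^ 2)] reaches the layer of [q],
    its [q]-th power lies below that layer, and coprimality to all later primes makes this power
    trivial, against the minimality of [n]. *)
Lemma tower_square_free (G : groupType) (N : nat -> set G) (x : G) n :
  is_tower N -> is_order x n -> square_free n.
Proof.
move=> tN [n_gt0 xn min_n] d dv_d; apply/eqP/idPn => d_neq1.
have d_gt1 : (1 < d)%N.
  by case: d d_neq1 dv_d => [|[]] //; rewrite dvd0n => _ /eqP n0; rewrite n0 in n_gt0.
have q_pr := pdiv_prime d_gt1; set q := pdiv d in q_pr.
have dv_q : (q ^ 2 %| n)%N by apply: dvdn_trans dv_d; rewrite dvdn_exp2r // pdiv_dvd.
set m := (n %/ q ^ 2)%N.
have def_n : n = (m * q * q)%N by rewrite -mulnA mulnn /m divnK.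
have xmq2 : (x ^+ m) ^+ (q ^ 2) = 1 by rewrite -expgnA -mulnn mulnA -def_n.
have xmq : x ^+ (m * q) = 1.
  rewrite expgnA; have [co_q|[i eq_qi co_q]] := prime_seq_coprime q_pr.
    have -> : x ^+ m = 1; last exact: expg1n.
    apply: (tower_coprime_eq1 tN (i := 0) _ xmq2) (tower0 tN _) => j _.
    exact: coprimeXl.
  apply: (tower_coprime_eq1 tN (i := i.+1) (n := q)).
  - by move=> j lt_ij; apply/co_q; rewrite neq_ltn lt_ij orbT.
  - by rewrite -(expgnA (x ^+ m)) mulnn.
  rewrite [X in _ ^+ m ^+ X]eq_qi; apply/(towerX tN).
  apply: (tower_prime_reach tN _ xmq2) => j lt_ji.
  by apply/coprimeXl/co_q; rewrite neq_ltn lt_ji.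
have mq_gt0 : (0 < m * q)%N by move: n_gt0; rewrite def_n muln_gt0 => /andP[].
have := min_n _ mq_gt0 xmq; rewrite {1}def_n -{2}[(m * q)%N]muln1 leq_pmul2l //.
by rewrite leqNgt prime_gt1.
Qed.

(** * Passage to subgroups, quotients and sections *)

Lemma towered_inj (G H : groupType) (f : H -> G) :
  {morph f : x y / x * y} -> injective f -> towered G -> towered H.
Proof.
move=> fM f_inj [torG [N tN]].
have f_eq1 x : f x = 1 -> x = 1 by rewrite -(morph_mul1 fM) => /f_inj.
split=> [x|].
  have [n n_gt0 fxn] := torG (f x); exists n => //.
  by apply: f_eq1; rewrite (morph_mulX fM).
exists (fun i x => N i (f x)); split.
- move=> i; have nN := tower_normal tN i; split=> [|x y Nx Ny|x y Nx].
  + by rewrite (morph_mul1 fM); apply: nsub1.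
  + by rewrite fM (morph_mulV fM); apply: nsubFl.
  + by rewrite (morph_mulJ fM); apply: nsubJ.
- by move=> x; apply: tower0.
- by move=> i x; apply: towerS.
- by move=> i x Nx; rewrite (morph_mulX fM); apply: towerX.
- by move=> i x y Nx Ny; rewrite (morph_mulR fM); apply: towerR.
- move=> i; have [F [g gN]] := tower_index tN i; exists F, (g \o f) => x y /gN.
  by rewrite fM (morph_mulV fM).
- by move=> x Nx; apply/f_eq1/(tower_cap tN).
Qed.

(* If [f x ^+ n = 1] and [x] lies in layer [n], then the order of [x] only involves
   primes larger than [n], so it is coprime to [n] and [f x = 1]. *)
Lemma towered_surj (G H : groupType) (f : G -> H) :
    {morph f : x y / x * y} -> (forall y, exists x, f x = y) ->
  towered G -> towered H.
Proof.
move=> fM f_surj [torG [N tN]].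
have torH : torsion H.
  move=> y; have [x <-] := f_surj y; have [n n_gt0 xn] := torG x.
  by exists n; rewrite // -(morph_mulX fM) xn (morph_mul1 fM).
split=> //; exists (fun i y => exists2 x, N i x & f x = y); split.
- move=> i; have nN := tower_normal tN i;
  split=> [|_ _ [x Nx <-] [y Ny <-]|_ z [x Nx <-]].
  + by exists 1; [apply: nsub1 | apply: morph_mul1].
  + by exists (x^-1 * y); [apply: nsubFl | rewrite fM (morph_mulV fM)].
  + have [y <-] := f_surj z.
    by exists (x ^ y); [apply: nsubJ | apply: morph_mulJ].
- by move=> y; have [x <-] := f_surj y; exists x => //; apply: tower0.
- by move=> i _ [x Nx <-]; exists x => //; apply: towerS.
- by move=> i _ [x Nx <-]; exists (x ^+ prime_seq i); [apply: towerX | apply: morph_mulX].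
- move=> i _ _ [x Nx <-] [y Ny <-].
  by exists [~ x, y]; [apply: towerR | apply: morph_mulR].
- move=> i; have [F [g gN]] := tower_index tN i.
  have [r rK] := choice f_surj.
  exists F, (g \o r) => x y /gN Nxy; exists ((r x)^-1 * r y) => //.
  by rewrite fM (morph_mulV fM) !rK.
move=> y Ny; have [n n_gt0 yn] := torH y; have [x Nx fx] := Ny n.
have [m m_gt0 xm] := torG x.
have min_x : exists m, [&& (0 < m)%N & x ^+ m == 1] by exists m; rewrite m_gt0 xm eqxx.
case: (ex_minnP min_x) => o /andP[o_gt0 /eqP xo] min_o.
have co_on : coprime o n.
  rewrite /coprime eqn_leq gcdn_gt0 o_gt0 andbT leqNgt; apply/negP => gt1.
  have [q q_pr] : exists2 q, prime q & (q %| gcdn o n)%N.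
    by exists (pdiv (gcdn o n)); [apply: pdiv_prime | apply: pdiv_dvd].
  rewrite dvdn_gcd => /andP[q_o q_n].
  (* As [q <= n], it is smaller than every prime from layer [n] on, so an element of [N n] killed by
     [q] is trivial. *)
  have xoq : x ^+ (o %/ q) = 1.
    apply: (tower_coprime_eq1 tN (n := q)) (nsubX (tower_normal tN n) _ Nx).
      move=> j le_nj; apply: coprime_prime_seq.
      by rewrite prime_gt0 // (leq_trans (dvdn_leq n_gt0 q_n)).
    by rewrite -expgnA divnK.
  have oq_gt0 : (0 < o %/ q)%N by rewrite (divn_gt0 _ (prime_gt0 q_pr)); apply: dvdn_leq.
  have := min_o (o %/ q)%N; rewrite oq_gt0 xoq eqxx => /(_ isT).
  by rewrite leqNgt ltn_Pdiv ?prime_gt1.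
(* Both [o] and [n] kill [y]: Bezout is applied to the trivial subgroup. *)
apply: (nsub_coprime (N := [set 1%g]%classic) (x := y) _ co_on).
- split=> [|_ _ -> ->|_ z ->] //=; first by rewrite invg1 mulg1.
  by rewrite conj1g.
- by rewrite /= -fx -(morph_mulX fM) xo (morph_mul1 fM).
- exact: yn.
Qed.

Lemma towered_section (Q S : groupType) : towered Q -> is_section Q S -> towered S.
Proof.
move=> tQ [P [H [N [f [g fK gK]]]]].
have tH : towered H by apply: (towered_inj (f := val)) tQ; [apply: valM | apply: val_inj].
have tHN : towered (quot N).
  apply: (towered_surj (f := \pi_(quot N))) tH; first exact: quot_piM.
  by elim/quotW=> x; exists x.
by apply: (towered_inj (f := g)) tHN; [apply: (can2_gmulfM fK gK) | apply: can_inj gK].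
Qed.

(** * Finite quotients *)

Section FiniteGroup.
Variables (G : groupType) (F : finType) (g : G -> F).
Hypothesis g_inj : injective g.

Let h y := if pselect (exists x, g x = y) is left e then Some (projT1 (cid e)) else None.

Let gK : pcancel g h.
Proof.
move=> x; rewrite /h; case: pselect => [e|[]]; last by exists x.
by congr Some; apply: g_inj; case: cid.
Qed.

(** The alias carries the injectivity proof, so that the finite group structure is attached to it
    rather than to [G]. *)
Definition fin_copy of injective g : Type := G.

Let T := fin_copy g_inj.

HB.instance Definition _ := Group.copy T G.
HB.instance Definition _ : isCountable T := PCanIsCountable gK.
HB.instance Definition _ : isFinite T := PCanIsFinite (gK : @pcancel F T g h).

Lemma isomorphic_finGroup :
  exists (K : finGroupType) (f : {multiplicative G -> K}), bijective f.
Proof.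
exists T, idfun.
by exists id.
Qed.

End FiniteGroup.

Lemma finite_quotient (G : groupType) (N : set G) (F : finType) (g : G -> F) :
    normal_subgroup N -> (forall x y, g x = g y -> N (x^-1 * y)) ->
  exists (K : finGroupType) (f : {multiplicative G -> K}),
    (forall x, f x = 1 -> N x) /\ (forall y, exists x, f x = y).
Proof.
move=> nN gN; have [M ME] := normal_closedP nN.
have r_inj : injective (g \o (@generic_quotient.repr _ (quot M))).
  move=> a b /gN Nab; rewrite -[a]reprK -[b]reprK; apply/eqP.
  by rewrite quot_eqE ME; apply/asboolP.
have [K [f [f' fK f'K]]] := isomorphic_finGroup r_inj.
have fM : {morph f : x y / x * y} by exact: gmulfM.
have fpM : {morph f \o \pi_(quot M) : x y / x * y}.
  by move=> x y /=; rewrite quot_piM gmulfM.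
pose mf := isMultiplicative.Build G K (f \o \pi_(quot M)) fpM.
exists K, (HB.pack (f \o \pi_(quot M)) mf : {multiplicative G -> K}); split=> /= [x|y].
  rewrite -(morph_mul1 fM) => /(can_inj fK)/eqP.
  by rewrite quot_pi_eq1 ME => /asboolP.
exists (generic_quotient.repr (f' y)).
by rewrite reprK f'K.
Qed.

Lemma towered_residually_finite (G : groupType) : towered G -> residually_finite G.
Proof.
case=> _ [N tN] x x_neq1.
have [i nNx] : exists i, ~ N i x.
  by apply/existsNP => Nx; move/eqP: x_neq1; apply; apply: (tower_cap tN).
have [F [g gN]] := tower_index tN i.
have [K [f [fN _]]] := finite_quotient (tower_normal tN i) gN.
by exists K, f; apply/eqP => /fN.
Qed.

(** * Finite and nilpotent groups with a tower *)

Lemma towered_Sylow_abelian (S : finGroupType) p (P : {group S}) :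
  towered S -> prime p -> p.-Sylow([set: S]) P -> abelian P.
Proof.
case=> _ [N tN] p_pr /pHall_pgroup pP.
have xp (x : S) : x \in P -> x ^+ (p ^ logn p #|P|) = 1.
  by move=> Px; rewrite -p_part part_pnat_id // expg_cardG.
apply/centsP => x Px y Py.
by apply: tower_primary_commute tN p_pr (xp _ Px) (xp _ Py) (xp _ _); apply: groupR.
Qed.

(** [solvable] asks that a subgroup contained in its own derived subgroup be trivial; such a
    subgroup descends through all the abelian layers. *)
Lemma towered_solvable (S : finGroupType) : towered S -> solvable [set: S].
Proof.
case=> _ [N tN]; apply/forall_inP => G; rewrite finset.subsetI => /andP[_ sG].
have GN i x : x \in G -> N i x.
  elim: i x => [|i IHi] x; first by move=> _; apply: (tower0 tN).
  move/(fintype.subsetP sG) => Gx.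
  have [M ME] := normal_closedP (tower_normal tN i.+1).
  have gM : group_set [set z | z \in M].
    apply/group_setP; split=> [|a b]; rewrite !inE; [exact: gpred1 | exact: gpredM].
  suff /fintype.subsetP/(_ x Gx) : [~: G, G] \subset group gM.
    by rewrite inE ME => /asboolP.
  rewrite gen_subG; apply/fintype.subsetP => _ /imset2P[a b Ga Gb ->].
  by rewrite inE ME; apply/asboolP/(towerR tN); apply: IHi.
rewrite -subG1; apply/fintype.subsetP => x Gx; rewrite inE.
by apply/eqP/(tower_cap tN) => i; apply: GN.
Qed.

(** Each Sylow subgroup is a direct factor, hence central once abelian, and the Sylow subgroups
    generate. *)
Lemma nilpotent_Sylow_abelian (gT : finGroupType) (G : {group gT}) :
    nilpotent G ->
    (forall p (P : {group gT}), prime p -> p.-Sylow(G) P -> abelian P) ->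
  abelian G.
Proof.
move=> nilG abP; suff : G \subset 'Z(G) by rewrite finset.subsetI => /andP[].
rewrite -{1}(Sylow_gen G) gen_subG; apply/bigcupsP => P /SylowP[p p_pr sylP].
have defP := nilpotent_Hall_pcore nilG sylP.
have /dprodP[_ defG cPP' _] := nilpotent_pcoreC p nilG.
rewrite finset.subsetI (pHall_sub sylP) /= -{1}defG -defP centM finset.subsetI.
by rewrite -/(abelian P) (abP p) // defP; rewrite centsC.
Qed.

(** For finite groups [nilpotent] asks that every such [A] be trivial. If term [n] of the series
    covers [A], then term [n.+1] covers [[~: A, [set: K]]], hence [A] again. *)
Lemma lower_central_image (G : groupType) (K : finGroupType) (f : {multiplicative G -> K})
    (A : {group K}) n :
    (forall y, exists x, f x = y) -> A \subset [~: A, [set: K]] ->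
  forall y, y \in A -> exists2 x, lower_central n x & f x = y.
Proof.
move=> f_surj sA; have fM : {morph f : x y / x * y} by exact: gmulfM.
elim: n => [|n IHn] y Ay.
  by have [x fx] := f_surj y; exists x.
rewrite -[lower_central _]/(subgroup_generated _).
set C := [set z | _]%classic.
have gB : group_set [set y : K | `[< exists2 x, subgroup_generated C x & f x = y >]].
  apply/group_setP; split=> [|a b]; last first.
    rewrite !finset.in_set => /asboolP[x Lx fx] /asboolP[z Lz fz].
    apply/asboolP; exists (x * z); last by rewrite fM fx fz.
    move=> M CM; have [[M1 MF] _] := CM; apply/set_mem.
    have := group_closedM (conj M1 MF); apply; apply/mem_set; first exact: Lx.
    exact: Lz.
  rewrite finset.in_set; apply/asboolP; exists 1; last exact: morph_mul1.
  by move=> M [[M1 _] _]; apply/set_mem.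
suff /fintype.subsetP/(_ y (fintype.subsetP sA _ Ay)) : [~: A, [set: K]] \subset group gB.
  by rewrite finset.in_set => /asboolP.
rewrite gen_subG; apply/fintype.subsetP => _ /imset2P[a b Aa _ ->].
rewrite finset.in_set; apply/asboolP.
have [x Lx <-] := IHn a Aa; have [z <-] := f_surj b.
exists [~ x, z]; last exact: (morph_mulR fM).
by apply: sub_gen_smallest; exists x => //; exists z.
Qed.

Lemma nilpotent_image (G : groupType) (K : finGroupType) (f : {multiplicative G -> K}) :
  (forall y, exists x, f x = y) -> nilpotent_group G -> nilpotent [set: K].
Proof.
move=> f_surj [n nilG]; have fM : {morph f : x y / x * y} by exact: gmulfM.
apply/forall_inP => A; rewrite finset.subsetI => /andP[_ sA].
rewrite -subG1; apply/fintype.subsetP => y /(lower_central_image n f_surj sA)[x].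
by rewrite nilG => -> <-; rewrite inE (morph_mul1 fM).
Qed.

(** Each finite quotient by some [N i] is nilpotent with abelian Sylow subgroups, so commutators lie
    in every [N i]. *)
Lemma towered_nilpotent_abelian (G : groupType) :
  towered G -> nilpotent_group G -> abelian_group G.
Proof.
move=> tG nilG x y; have [_ [N tN]] := tG.
apply/commgP/eqP/(tower_cap tN) => i; have [F [g gN]] := tower_index tN i.
have [K [f [fN f_surj]]] := finite_quotient (tower_normal tN i) gN.
have fM : {morph f : x y / x * y} by exact: gmulfM.
have cKK := nilpotent_Sylow_abelian (nilpotent_image f_surj nilG)
  (fun p P => @towered_Sylow_abelian K p P (towered_surj fM f_surj tG)).
apply: fN; rewrite (morph_mulR fM); apply/eqP/commgP.
exact: (centsP cKK).
Qed.

(** * Just infinite quotients *)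

Lemma subgroup_generated_ind (G : groupType) (A P : set G) :
    P 1 -> (forall x y, P x -> P y -> P (x * y^-1)) -> (A `<=` P)%classic ->
  (subgroup_generated A `<=` P)%classic.
Proof.
move=> P1 PF sAP x; apply; split=> //; split=> [|y z]; first exact/mem_set.
by move=> /set_mem Py /set_mem Pz; apply/mem_set/PF.
Qed.

Lemma subgroup_generated1 (G : groupType) (A : set G) : subgroup_generated A 1.
Proof. by move=> K [[K1 _] _]; apply/set_mem. Qed.

Lemma subgroup_generatedF (G : groupType) (A : set G) x y :
  subgroup_generated A x -> subgroup_generated A y -> subgroup_generated A (x * y^-1).
Proof.
move=> Ax Ay K KA; have [[_ KF] _] := KA.
by apply/set_mem/KF; apply/mem_set; [apply: Ax | apply: Ay].
Qed.

Lemma finitely_generated_surj (G H : groupType) (f : G -> H) :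
    {morph f : x y / x * y} -> (forall y, exists x, f x = y) ->
  finitely_generated G -> finitely_generated H.
Proof.
move=> fM f_surj [s Gs]; exists (map f s); apply/seteqP; split=> // y _.
have [x <-] := f_surj y; have : subgroup_generated [set` s]%classic x by rewrite Gs.
move: x; apply: subgroup_generated_ind => [|x z Kx Kz|x /= sx].
- by rewrite (morph_mul1 fM); apply: subgroup_generated1.
- by rewrite fM (morph_mulV fM); apply: subgroup_generatedF.
by apply: sub_gen_smallest; rewrite /= map_f.
Qed.

Definition finite_index (G : groupType) (N : set G) :=
  exists s : seq G, forall x, exists2 t, t \in s & N (t^-1 * x).

Lemma finite_quotP (G : groupType) (N : normalClosed G) :
  finite_group (quot N) <-> finite_index (fun x => x \in N).
Proof.
split=> [/finite_seqP[s def_s]|[s sN]]; last first.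
  apply/finite_seqP; exists [seq \pi_(quot N) t | t <- s].
  apply/seteqP; split=> //; elim/quotW=> x _ /=.
  have [t s_t Ntx] := sN x; apply/mapP; exists t => //.
  by apply/esym/eqP; rewrite quot_eqE.
exists [seq generic_quotient.repr a | a <- s] => x.
exists (generic_quotient.repr (\pi_(quot N) x)).
  by rewrite map_f //; have : [set` s]%classic (\pi_(quot N) x) by rewrite -def_s.
by rewrite -quot_eqE reprK.
Qed.

(** Of two comparable members the larger keeps all points found so far; [A] serves for the empty
    list. *)
Lemma chain_cover (T : eqType) (F : set (set T)) (A : set T) (s : seq T) :
    total_on F subset -> F A -> {in s, forall x, (\bigcup_(X in F) X)%classic x} ->
  exists2 X, F X & {in s, forall x, X x}.
Proof.
move=> totF FA; elim: s => [|x s IHs] sF; first by exists A.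
have [y s_y|X FX sX] := IHs; first by apply: sF; rewrite inE s_y orbT.
have [Y FY Yx] := sF x (mem_head x s).
have [sXY|sYX] := totF _ _ FX FY; [exists Y|exists X] => // y; rewrite inE.
  by case/predU1P=> [->|/sX/sXY].
by case/predU1P=> [->|/sX] //; apply: sYX.
Qed.

(* If finitely many cosets of the union cover the group, the finitely many
   elements witnessing that they are permuted by the generators already lie in
   one member of the chain. *)
Lemma finite_index_chain (G : groupType) (F : set (set G)) (A : set G) :
    finitely_generated G -> total_on F subset -> F A ->
    (forall X, F X -> normal_subgroup X) ->
    finite_index (\bigcup_(X in F) X)%classic ->
  exists2 X, F X & finite_index X.
Proof.
move=> [s Gs] totF FA nF [T covT].
have /choice[c cT] x : exists t, t \in T /\ (\bigcup_(X in F) X)%classic (t^-1 * x).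
  by have [t] := covT x; exists t.
pose ss := s ++ [seq x^-1 | x <- s].
(* Only for these elements must [X] already witness the chosen coset. *)
pose l := 1 :: [seq t * x | t <- T, x <- ss].
have [_ /mapP[y _ ->]|X FX lX] := @chain_cover _ F A [seq (c y)^-1 * y | y <- l] totF FA.
  by have [] := cT y.
exists X => //; exists T.
have nX := nF X FX.
(* Right multiplication by [x] sends each coset [t X] with [t] in [T] to another such coset. *)
pose K (x : G) := forall t : G, t \in T -> exists2 u, u \in T & X (u^-1 * (t * x)).
have KM x y : K x -> K y -> K (x * y).
  move=> Kx Ky t /Kx[u /Ky[v Tv Xvuy] Xutx]; exists v => //.
  have -> : v^-1 * (t * (x * y)) = v^-1 * (u * y) * (u^-1 * (t * x)) ^ y.
    by rewrite conjgE -!mulgA !mulKVg.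
  by apply: (nsubM nX) => //; apply: (nsubJ nX).
have Ks x : x \in ss -> K x.
  move=> ss_x t Tt; exists (c (t * x)); first by have [] := cT (t * x).
  apply: lX; apply: (map_f (fun y => (c y)^-1 * y)).
  by rewrite inE; apply/orP; right; apply: allpairs_f.
have K1 : K 1.
  by move=> t Tt; exists t; rewrite // mulg1 mulVg; apply: nsub1.
have KG x : K x /\ K x^-1.
  have : subgroup_generated [set` s]%classic x by rewrite Gs.
  move: x; apply: subgroup_generated_ind => [|x y [Kx Kx'] [Ky Ky']|x /= s_x].
  - by rewrite invg1.
  - by rewrite invgF; split; apply: KM.
  by split; apply: Ks; rewrite mem_cat ?s_x ?map_f ?orbT.
(* The coset of 1 is one of these, and [x] moves it to the coset of [x]. *)
move=> x; have [_ X1] : c 1 \in T /\ X ((c 1)^-1 * 1).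
  split; first by have [] := cT 1.
  by apply: lX; apply: (map_f (fun y => (c y)^-1 * y)); rewrite mem_head.
have [u Tu Xu] := (KG x).1 (c 1) (cT 1).1.
exists u => //.
have -> : u^-1 * x = u^-1 * (c 1 * x) * ((c 1)^-1 * 1) ^ x.
  by rewrite conjgE mulg1 -!mulgA !mulKVg.
by apply: (nsubM nX) => //; apply: (nsubJ nX).
Qed.

Lemma just_infinite_quotient (G : groupType) :
    finitely_generated G -> ~ finite_group G ->
  exists N : normalClosed G, just_infinite (quot N).
Proof.
move=> fgG infG.
pose P (A : set G) := A = set0 \/ (normal_subgroup A /\ ~ finite_index A).
have P1 : P [set 1]%classic.
  right; split=> [|[s sG]].
    split=> [|_ _ -> ->|_ z ->] //=; first by rewrite invg1 mulg1.
    by rewrite conj1g.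
  apply: infG; apply/finite_seqP; exists s; apply/seteqP; split=> // x _ /=.
  by have [t s_t /mulg1_eq <-] := sG x; rewrite invgK.
have [|A [PA maxA]] := @Zorn_bigcup _ P.
  move=> F FP totF.
  have [[A [FA A1]]|noF] := pselect (exists A, F A /\ A 1); last first.
    left; apply/seteqP; split=> // x [X FX Xx].
    have [X0|[nX _]] := FP X FX; first by rewrite X0 in Xx.
    by case: noF; exists X; split=> //; apply: nsub1.
  right.
  pose F' := [set X | F X /\ X 1]%classic.
  have UF : (\bigcup_(X in F) X = \bigcup_(X in F') X)%classic.
    apply/seteqP; split=> x [X FX Xx]; exists X => //; last by case: FX.
    split=> //; have [X0|[nX _]] := FP X FX; first by rewrite X0 in Xx.
    exact: nsub1.
  have nF X : F' X -> normal_subgroup X.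
    by case=> /FP[->|[]].
  have totF' : total_on F' subset by move=> X Y [FX _] [FY _]; apply: totF.
  rewrite UF; split; last first.
    case/(finite_index_chain fgG totF' (conj FA A1) nF) => X [/FP[->|[_ noX]]] //.
  split=> [|x y [X FX Xx] [Y FY Yy]|x y [X FX Xx]].
  - by exists A.
  - have [sXY|sYX] := totF' _ _ FX FY; [exists Y|exists X] => //.
      by apply: (nsubFl (nF _ FY)) => //; apply: sXY.
    by apply: (nsubFl (nF _ FX)) => //; apply: sYX.
  by exists X => //; apply: (nsubJ (nF _ FX)).
case: PA => [A0|[nA infA]].
  case: (maxA [set 1]%classic) => //; rewrite A0; split=> //.
  by move/(_ 1 erefl).
have [M ME] := normal_closedP nA; exists M.
have eqM : (fun x => x \in M : Prop) = A.
  by apply/funext => x; rewrite ME; apply/propext; split=> /asboolP.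
split=> [/finite_quotP|N [a Na a_neq1]]; first by rewrite eqM.
(* The preimage of [N] contains [A] strictly, so by maximality it has finite index. *)
pose B : set G := fun x => \pi_(quot M) x \in N.
have piM := @quot_piM G M.
have nB : normal_subgroup B.
  have nN := normalClosed_subgroup N.
  split=> [|x y Nx Ny|x y Nx]; rewrite /B.
  - by rewrite (morph_mul1 piM) gpred1.
  - by rewrite piM (morph_mulV piM); apply: (nsubFl nN).
  by rewrite (morph_mulJ piM); apply: (nsubJ nN).
have sAB x : A x -> B x.
  rewrite -eqM -quot_pi_eq1 => /eqP x1.
  by rewrite /B x1 gpred1.
have [s sB] : finite_index B.
  apply: contrapT => infB; case: (maxA B); last by right.
  split=> // sBA; move: a a_neq1 Na; elim/quotW=> x.
  by rewrite quot_pi_eq1 => /negP Mx /sBA; rewrite -eqM.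
apply/finite_quotP; exists [seq \pi_(quot M) t | t <- s]; elim/quotW=> x.
have [t s_t Bt] := sB x; exists (\pi_(quot M) t); first by rewrite map_f.
by rewrite -(morph_mulV piM) -piM.
Qed.

(** * Coverings of Cayley graphs *)

(** Words are positive: in a torsion group inverses are powers, so two letters without inverses
    suffice. *)
Definition eval (G : groupType) (a : bool -> G) (w : seq bool) : G :=
  \prod_(x <- w) a x.

Lemma eval_cat (G : groupType) (a : bool -> G) u v :
  eval a (u ++ v) = eval a u * eval a v.
Proof. exact: big_cat. Qed.

Lemma eval_cons (G : groupType) (a : bool -> G) x w : eval a (x :: w) = a x * eval a w.
Proof. exact: big_cons. Qed.

Definition pow_word (w : seq bool) n := flatten (nseq n w).

Lemma eval_pow (G : groupType) (a : bool -> G) w n :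
  eval a (pow_word w n) = eval a w ^+ n.
Proof.
elim: n => [|n IHn]; first exact: big_nil.
by rewrite /pow_word /= eval_cat IHn expgS.
Qed.

Lemma pow_wordS w n : pow_word w n.+1 = w ++ pow_word w n. Proof. by []. Qed.

Lemma pow_wordSr w n : pow_word w n.+1 = pow_word w n ++ w.
Proof. by elim: n => [|n IHn]; rewrite pow_wordS ?cats0 // {1}IHn catA -pow_wordS. Qed.

(** * Walks along labelled edges *)

Section CayleyCover.
Import GRing.Theory.
Variables (G : finGroupType) (a : bool -> G) (p : nat).

Section Walk.
Variable m : {ffun bool * G -> ('F_p)^o}.

(** The edge from [h] to [h * a x] carries the label [m (x, h)]; labels are added along the path
    from [h] spelled by [w]. *)
Fixpoint walk (h : G) (w : seq bool) : 'F_p :=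
  if w is x :: w' then (m (x, h) + walk (h * a x) w')%R else 0%R.

Lemma walk_cat h u v : walk h (u ++ v) = (walk h u + walk (h * eval a u) v)%R.
Proof.
elim: u h => [|x u IHu] h /=; first by rewrite add0r /eval big_nil mulg1.
by rewrite IHu eval_cons addrA mulgA.
Qed.

Definition cover_fun (x : bool) (hv : G * 'F_p) : G * 'F_p :=
  (hv.1 * a x, (hv.2 + m (x, hv.1))%R).

Lemma cover_fun_inj x : injective (cover_fun x).
Proof.
move=> [h u] [k v] eq_hk; have /mulIg/= eq_h := congr1 fst eq_hk.
by have := congr1 snd eq_hk; rewrite /= eq_h => /addIr->.
Qed.

Definition cover_perm x : {perm G * 'F_p} := perm (@cover_fun_inj x).

Lemma eval_cover w h v :
  eval cover_perm w (h, v) = (h * eval a w, (v + walk h w)%R).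
Proof.
elim: w h v => [|x w IHw] h v /=.
  by rewrite /eval !big_nil perm1 mulg1 addr0.
by rewrite !eval_cons permM permE /cover_fun IHw /= mulgA addrA.
Qed.

Lemma walk_pow h w k n : eval a w ^+ n = 1 ->
  walk (h * eval a w ^+ k) (pow_word w n) = walk h (pow_word w n).
Proof.
move=> wn; elim: k => [|k <-]; first by rewrite mulg1.
rewrite expgSr mulgA; set h' := h * _.
have : walk h' (w ++ pow_word w n) = walk h' (pow_word w n ++ w).
  by rewrite -pow_wordS pow_wordSr.
by rewrite !walk_cat eval_pow wn mulg1 addrC => /addIr.
Qed.

Lemma walk_pow_closed h w n :
  eval a w = 1 -> walk h (pow_word w n) = (walk h w *+ n)%R.
Proof.
move=> w1; elim: n => // n IHn.
by rewrite pow_wordS walk_cat w1 mulg1 IHn mulrS.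
Qed.

End Walk.

(** * Linear algebra on the labels *)

Lemma walk_linear k (m1 m2 : {ffun bool * G -> ('F_p)^o}) h w :
  walk (k *: m1 + m2)%R h w = (k * walk m1 h w + walk m2 h w)%R.
Proof.
elim: w h => [|x w IHw] h /=; first by rewrite mulr0 addr0.
by rewrite IHw !ffunE mulrDr addrACA.
Qed.

(** The coboundary of a function on vertices: it telescopes to 0 along closed paths. *)
Definition gradient (f : {ffun G -> ('F_p)^o}) : {ffun bool * G -> ('F_p)^o} :=
  [ffun xh => f (xh.2 * a xh.1)%g - f xh.2]%R.

Fact gradient_linear : linear gradient.
Proof. by move=> k f g; apply/ffunP => xh; rewrite !ffunE scalerBr opprD addrACA. Qed.

HB.instance Definition _ := GRing.isLinear.Build _ _ _ _ gradient gradient_linear.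

Variables (I : finType) (P : pred I) (w : I -> seq bool).

Let order_w i := #[eval a (w i)].

(* The walk of a power equal to 1 of a word is the same from all base points of
   a coset of the cyclic group it generates. *)
Let base := {x : I * {set G} | P x.1 && (x.2 \in lcosets <[eval a (w x.1)]> [set: G])}.

Definition relator_walks (m : {ffun bool * G -> ('F_p)^o}) : {ffun base -> ('F_p)^o} :=
  [ffun b => walk m (repr (val b).2) (pow_word (w (val b).1) (order_w (val b).1))].

Fact relator_walks_linear : linear relator_walks.
Proof. by move=> k f g; apply/ffunP => b; rewrite !ffunE walk_linear. Qed.

HB.instance Definition _ := GRing.isLinear.Build _ _ _ _ relator_walks
  relator_walks_linear.

Lemma card_base : #|{: base}| = (\sum_(i | P i) #|G| %/ order_w i)%N.
Proof.
pose cosets i : {set {set G}} := lcosets <[eval a (w i)]> [set: G].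
rewrite card_sig -sum1_card -(pair_big_dep P (fun i C => C \in cosets i) (fun _ _ => 1%N)) /=.
apply: eq_bigr => i _; rewrite sum1_card /order_w -cardsT divgS ?finset.subsetT //.
by rewrite -card_lcosets.
Qed.

(** [walk_pow] carries vanishing at the coset representative to the whole coset. *)
Lemma relator_walks_eq0 m i h :
  relator_walks m = 0%R -> P i -> walk m h (pow_word (w i) (order_w i)) = 0%R.
Proof.
move=> m0 Pi; pose C := h *: <[eval a (w i)]>.
have bP : P (i, C).1 && ((i, C).2 \in lcosets <[eval a (w (i, C).1)]> [set: G]).
  by rewrite /= Pi; apply/lcosetsP; exists h; rewrite ?inE.
have := congr1 (fun f : {ffun base -> ('F_p)^o} => f (Sub (i, C) bP)) m0.
rewrite !ffunE SubK /=.
have /lcosetP[_ /cycleP[k ->] ->] := mem_repr h (lcoset_refl <[eval a (w i)]> h).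
by rewrite walk_pow // expg_order.
Qed.

Lemma dim_labels (T : finType) : \dim {: {ffun T -> ('F_p)^o}} = #|T|.
Proof. by rewrite dimvf -[LHS]/(#|T| * 1)%N muln1. Qed.

(** Labels have dimension [2 |G|] and the relators impose fewer than [|G|] conditions, so the kernel
    has dimension above [|G|], too large to consist of gradients. *)
Lemma exists_label : (\sum_(i | P i) #|G| %/ order_w i < #|G|)%N ->
  exists2 m, relator_walks m = 0%R & forall f, m <> gradient f.
Proof.
move=> lt_sum; pose C := linfun relator_walks; pose D := linfun gradient.
have [/dimvS le_dim|/subvPn[m]] := boolP (lker C <= limg D)%VS; last first.
  rewrite memv_ker lfunE => /eqP Cm nDm; exists m => // f def_m.
  by case/negP: nDm; rewrite def_m -(lfunE gradient f) memv_img ?memvf.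
have := limg_ker_dim C fullv; rewrite capfv dim_labels card_prod card_bool => dimC.
have := limg_ker_dim D fullv; rewrite dim_labels => dimD.
have := dimvS (subvf (limg C)); rewrite dim_labels card_base => dim_imC.
suff arith s n kC iC kD iD : (s < n)%N -> (kC + iC = 2 * n)%N -> (kD + iD = n)%N ->
    (kC <= iD)%N -> (iC <= s)%N -> False.
  by case: (arith _ _ _ _ _ _ lt_sum dimC dimD le_dim dim_imC).
lia.
Qed.

Hypothesis a_gen : forall g, exists u, eval a u = g.

(* The potential at [h] is the sum of the labels along any walk from 1 to [h]. *)
Lemma walk_closed_gradient m :
  (forall u, eval a u = 1 -> walk m 1 u = 0%R) -> exists f, m = gradient f.
Proof.
move=> m0; have /choice[u uE] := a_gen.
have walkE v v' : eval a v = eval a v' -> walk m 1 v = walk m 1 v'.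
  (* The word [t] closes both paths, and its contribution cancels. *)
  move=> eq_v; have [t tE] := a_gen (eval a v)^-1.
  have := m0 (v ++ t); rewrite eval_cat tE mulgV => /(_ erefl).
  have := m0 (v' ++ t); rewrite eval_cat tE eq_v mulgV => /(_ erefl).
  by rewrite !walk_cat !mul1g eq_v => <- /addIr.
exists [ffun h => walk m 1 (u h)]; apply/ffunP=> -[x h]; rewrite !ffunE /=.
have -> : walk m 1 (u (h * a x)) = walk m 1 (u h ++ [:: x]).
  by apply: walkE; rewrite uE eval_cat uE /eval big_seq1.
by rewrite walk_cat mul1g uE /= addr0 addrC addKr.
Qed.

End CayleyCover.

Lemma eval_morph (G H : groupType) (f : G -> H) (a : bool -> G) w :
  {morph f : x y / x * y} -> f (eval a w) = eval (f \o a) w.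
Proof.
move=> fM; elim: w => [|x w IHw]; first by rewrite /eval !big_nil (morph_mul1 fM).
by rewrite !eval_cons fM IHw.
Qed.

(** Values of positive words are closed under products, which in a finite group yields a subgroup;
    restricting to it restores generation. *)
Lemma generated_cover (K : finGroupType) (b : bool -> K) :
  exists (H : finGroupType) (c : bool -> H) (f : H -> K),
    [/\ {morph f : x y / x * y}, injective f, b = f \o c
      & forall g, exists u, eval c u = g].
Proof.
have gE : group_set [set g | `[< exists u, eval b u = g >]].
  apply/group_setP; split=> [|g h]; rewrite !finset.in_set.
    by apply/asboolP; exists [::]; apply: big_nil.
  move=> /asboolP[u <-] /asboolP[v <-]; apply/asboolP.
  by exists (u ++ v); apply: eval_cat.
pose A := group gE.
have Ab x : b x \in A.
  by rewrite finset.in_set; apply/asboolP; exists [:: x]; apply: big_seq1.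
have sgM : {morph (@sgval K A) : x y / x * y} by [].
have def_b : b = @sgval K A \o (fun x => subg A (b x)).
  by apply/funext => x; rewrite /= subgK.
exists (subg_of A : finGroupType), (fun x => subg A (b x)), (@sgval K A).
split=> //; first exact: val_inj.
move=> g; have := subgP g; rewrite finset.in_set => /asboolP[u ug].
by exists u; apply: val_inj; rewrite /= -ug (eval_morph _ _ sgM) -def_b.
Qed.

Section NextQuotient.
Import GRing.Theory.

(** A word trivial in [G] translates each fibre of the covering, which gives exponent [p] and
    commutation. The label vanishes on the relators but is no gradient, so some closed path has
    nonzero sum and yields a new element. *)
Lemma next_quotient (G : finGroupType) (a : bool -> G) p (I : finType) (P : pred I)
    (w : I -> seq bool) :
    prime p -> (forall g, exists u, eval a u = g) ->
    (\sum_(i | P i) #|G| %/ #[eval a (w i)] < #|G|)%N ->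
  exists (K : finGroupType) (b : bool -> K),
  [/\ forall g, exists u, eval b u = g,
      forall u v, eval b u = eval b v -> eval a u = eval a v,
      forall u, eval a u = 1 -> eval b u ^+ p = 1,
      forall u v, eval a u = 1 -> eval a v = 1 -> commute (eval b u) (eval b v) &
      (forall i, P i -> eval b (w i) ^+ #[eval a (w i)] = 1) /\
      exists2 u, eval a u = 1 & eval b u <> 1].
Proof.
move=> p_pr a_gen lt_sum; have [m m0 m_grad] := exists_label p lt_sum.
have [u au1 mu] : exists2 u, eval a u = 1 & walk a m 1 u <> 0%R.
  apply: contrapT => no_u;
  have [|f] := @walk_closed_gradient _ _ _ a_gen m; last exact: m_grad.
  by move=> u au1; apply: contrapT => mu; apply: no_u; exists u.
have [K [b [f [fM f_inj def_c b_gen]]]] := generated_cover (cover_perm a m).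
have fE w' : f (eval b w') = eval (cover_perm a m) w'.
  by rewrite (eval_morph _ _ fM) -def_c.
have f1 := morph_mul1 fM.
exists K, b; split=> //.
- move=> v v' /(congr1 f); rewrite !fE => /permP/(_ (1, 0%R)).
  by rewrite !eval_cover !mul1g => -[].
- move=> v av1; apply: f_inj; rewrite f1 -eval_pow fE; apply/permP=> -[h c].
  rewrite eval_cover perm1 eval_pow av1 expg1n mulg1 walk_pow_closed //.
  by rewrite (mulrn_pchar (pchar_Fp p_pr)) addr0.
- move=> v v' av1 av1'; apply: f_inj; rewrite !fM !fE; apply/permP=> -[h c].
  by rewrite !permM !eval_cover av1 av1' !mulg1 addrAC.
split=> [i Pi|].
  apply: f_inj; rewrite f1 -eval_pow fE; apply/permP=> -[h c].
  by rewrite eval_cover perm1 eval_pow expg_order mulg1 (relator_walks_eq0 _ m0) ?addr0.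
exists u => // bu1; apply: mu; have := fE u; rewrite bu1 f1 => /permP/(_ (1, 0%R)).
by rewrite perm1 eval_cover => /(congr1 snd)/=; rewrite add0r.
Qed.

End NextQuotient.

(** * The limit group *)

Record marked_group := MarkedGroup {
  mgroup :> finGroupType;
  mgen : bool -> mgroup;
  mgenP : forall g, exists u, eval mgen u = g
}.

Definition meval (M : marked_group) (u : seq bool) : M := eval (@mgen M) u.

Section Limit.
Variable M : nat -> marked_group.

Definition marked_prod : Type := forall k, M k.

HB.instance Definition _ := gen_eqMixin marked_prod.
HB.instance Definition _ := gen_choiceMixin marked_prod.

Fact marked_mulA : associative (fun (f g : marked_prod) k => f k * g k).
Proof. by move=> f g h; apply: functional_extensionality_dep => k; apply: mulgA. Qed.
Fact marked_mul1 : left_id (fun k => 1 : M k) (fun (f g : marked_prod) k => f k * g k).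
Proof. by move=> f; apply: functional_extensionality_dep => k; apply: mul1g. Qed.
Fact marked_mulg1 : right_id (fun k => 1 : M k) (fun (f g : marked_prod) k => f k * g k).
Proof. by move=> f; apply: functional_extensionality_dep => k; apply: mulg1. Qed.
Fact marked_mulV : left_inverse (fun k => 1 : M k) (fun (f : marked_prod) k => (f k)^-1)
  (fun (f g : marked_prod) k => f k * g k).
Proof. by move=> f; apply: functional_extensionality_dep => k; apply: mulVg. Qed.
Fact marked_mulgV : right_inverse (fun k => 1 : M k) (fun (f : marked_prod) k => (f k)^-1)
  (fun (f g : marked_prod) k => f k * g k).
Proof. by move=> f; apply: functional_extensionality_dep => k; apply: mulgV. Qed.

HB.instance Definition _ := isGroup.Build marked_prod
  marked_mulA marked_mul1 marked_mulg1 marked_mulV marked_mulgV.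

Definition diag_gen (x : bool) : marked_prod := fun k => @mgen (M k) x.

Definition diag_pred : {pred marked_prod} :=
  [pred f |
    `[< subgroup_generated [set` [:: diag_gen true; diag_gen false]]%classic f >]].

Fact diag_group_closed : group_closed diag_pred.
Proof.
split=> [|f g /asboolP Df /asboolP Dg]; apply/asboolP; first exact: subgroup_generated1.
exact: subgroup_generatedF.
Qed.

Definition limit := {f | diag_pred f}.

HB.instance Definition _ := SubChoice.on limit.
HB.instance Definition _ := SubChoice_isSubGroup.Build marked_prod diag_pred limit
  diag_group_closed.

Lemma diag_gen_limit x : diag_gen x \in diag_pred.
Proof.
have : diag_gen x \in [:: diag_gen true; diag_gen false].
  by case: x; rewrite !in_cons eqxx ?orbT.
by move=> Dx; apply/asboolP; apply: sub_gen_smallest; exact: Dx.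
Qed.

Definition limit_gen (x : bool) : limit := Sub (diag_gen x) (diag_gen_limit x).

Definition limit_proj k (f : limit) : M k := val f k.

Lemma limit_projM k : {morph @limit_proj k : f g / f * g}.
Proof. by []. Qed.

Lemma limit_proj_eval k u : limit_proj k (eval limit_gen u) = meval (M k) u.
Proof. by rewrite (eval_morph _ _ (@limit_projM k)). Qed.

Lemma limit_proj_inj (f g : limit) : (forall k, limit_proj k f = limit_proj k g) -> f = g.
Proof. by move=> fg; apply/val_inj/functional_extensionality_dep. Qed.

Hypothesis periodicM : forall u, exists2 n, (0 < n)%N & forall k, meval (M k) u ^+ n = 1.

(** The inverse of a word is its power [n.-1]; as [n] does not depend on [k], one positive word
    serves all coordinates. *)
Lemma limit_evalP f : exists u, eval limit_gen u = f.
Proof.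
suff valP : exists u, forall k, meval (M k) u = val f k.
  have [u uf] := valP; exists u; apply: limit_proj_inj => k.
  by rewrite limit_proj_eval uf.
have /asboolP := valP f; move: (val f); apply: subgroup_generated_ind.
- by exists [::] => k; apply: big_nil.
- move=> g h [u ug] [v vh]; have [n n_gt0 vn] := periodicM v.
  exists (u ++ pow_word v n.-1) => k; rewrite /meval eval_cat eval_pow.
  rewrite -/(meval _ u) -/(meval _ v) -[RHS]/(g k * (h k)^-1) -ug -vh; congr (_ * _).
  by apply: (mulIg (meval (M k) v)); rewrite mulVg -expgSr prednK ?vn.
move=> g /=; rewrite !in_cons orbF => /orP[]/eqP->.
  by exists [:: true] => k; apply: big_seq1.
by exists [:: false] => k; apply: big_seq1.
Qed.

Lemma limit_torsion : torsion limit.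
Proof.
move=> f; have [u <-] := limit_evalP f; have [n n_gt0 un] := periodicM u.
exists n => //; apply: limit_proj_inj => k.
by rewrite (morph_mulX (@limit_projM k)) limit_proj_eval un (morph_mul1 (@limit_projM k)).
Qed.

End Limit.

(** * Enumeration of the words and choice of the next group *)

Definition word (i : nat) : seq bool := odflt [::] (unpickle i).

Lemma wordP u : exists i, word i = u.
Proof. by exists (pickle u); rewrite /word pickleK. Qed.

(* The order of the [i]-th word is frozen once it reaches [2 ^ (i + 2)]; these
   bounds keep the sum of the inverses of the frozen orders below 1. *)
Record next_marked (k : nat) (M N : marked_group) : Prop := NextMarked {
  next_refine : forall u v, meval N u = meval N v -> meval M u = meval M v;
  next_exponent : forall u, meval M u = 1 -> meval N u ^+ prime_seq k = 1;
  next_commute : forall u v, meval M u = 1 -> meval M v = 1 ->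
    commute (meval N u) (meval N v);
  next_frozen : forall i, (i < k)%N -> (2 ^ i.+2 <= #[meval M (word i)])%N ->
    meval N (word i) ^+ #[meval M (word i)] = 1;
  next_proper : exists2 u, meval M u = 1 & meval N u <> 1
}.

(** Adding the remainder [n %/ 2 ^ k.+1] makes the induction work, since two halves rounded down
    never exceed the whole. *)
Lemma sum_div_exp2_lt n k : (0 < n)%N -> (\sum_(i < k) n %/ 2 ^ i.+2 < n)%N.
Proof.
move=> n_gt0; suff: (\sum_(i < k) n %/ 2 ^ i.+2 + n %/ 2 ^ k.+1 <= n %/ 2)%N.
  by move/(leq_trans (leq_addr _ _))/leq_ltn_trans; apply; apply: ltn_Pdiv.
elim: k => [|k IHk]; first by rewrite big_ord0 expn1.
rewrite big_ord_recr /=; apply: leq_trans IHk.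
by rewrite -addnA leq_add2l expnSr divnMA; lia.
Qed.

Lemma next_marked_exists k M : exists N, next_marked k M N.
Proof.
pose P (i : 'I_k) := (2 ^ i.+2 <= #[meval M (word i)])%N.
have [|K [b [bP refine expo comm [frozen proper]]]] :=
    @next_quotient M (@mgen M) (prime_seq k) 'I_k P (fun i => word i)
      (prime_prime_seq k) (@mgenP M).
  (* An imposed word has order at least [2 ^ i.+2]; other indices contribute 0. *)
  rewrite -cardsT; apply: leq_ltn_trans (sum_div_exp2_lt k (cardG_gt0 [set: M])).
  rewrite big_mkcond; apply: leq_sum => i _; case: ifP => // Pi.
  by apply: leq_div2l; rewrite ?expn_gt0.
exists (MarkedGroup bP); split=> // i lt_ik le_i.
exact: (frozen (Ordinal lt_ik) le_i).
Qed.

Lemma marked_trivial : exists M : marked_group, forall u, meval M u = 1.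
Proof.
have perm_void (s t : {perm void}) : s = t by apply/permP=> -[].
have gP (g : {perm void}) : exists u, eval (fun _ => 1 : {perm void}) u = g.
  by exists [::]; apply: perm_void.
by exists (MarkedGroup gP) => u; apply: perm_void.
Qed.

Lemma marked_tower_exists : exists M : nat -> marked_group,
  (forall u, meval (M 0) u = 1) /\ forall k, next_marked k (M k) (M k.+1).
Proof.
have [M0 M0_1] := marked_trivial.
have /choice[F FP] : forall kM : nat * marked_group, exists N, next_marked kM.1 kM.2 N.
  by move=> kM; apply: next_marked_exists.
exists (fun k => nat_rect (fun _ => marked_group) M0 (fun k M => F (k, M)) k).
by split=> // k; apply: (FP (k, _)).
Qed.

(** * Periodicity, tower and infinitude of the limit *)

Section MarkedTower.
Variable M : nat -> marked_group.
Hypothesis M_0 : forall u, meval (M 0) u = 1.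
Hypothesis M_next : forall k, next_marked k (M k) (M k.+1).

Lemma marked_tower_refine j k u v :
  (j <= k)%N -> meval (M k) u = meval (M k) v -> meval (M j) u = meval (M j) v.
Proof.
move/subnK<-; elim: (k - j)%N => // n IHn.
by rewrite addSn => /(next_refine (M_next _))/IHn.
Qed.

Lemma marked_tower_refine1 j k u :
  (j <= k)%N -> meval (M k) u = 1 -> meval (M j) u = 1.
Proof.
have eval_nil N : meval N [::] = 1 by apply: big_nil.
by move=> le_jk; rewrite -!(eval_nil (M _)); apply: marked_tower_refine.
Qed.

Lemma marked_tower_refineX j k u n :
  (j <= k)%N -> meval (M k) u ^+ n = 1 -> meval (M j) u ^+ n = 1.
Proof. by rewrite /meval -!eval_pow; apply: marked_tower_refine1. Qed.

(** The imposed relator makes the new order divide the old one; refinement gives the converse. *)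
Lemma marked_tower_frozen i k l : (i < k)%N -> (2 ^ i.+2 <= #[meval (M k) (word i)])%N ->
  (k <= l)%N -> #[meval (M l) (word i)] = #[meval (M k) (word i)].
Proof.
move=> lt_ik le_i /subnK<-; elim: (l - k)%N => // n IHn.
rewrite addSn; apply/eqP; rewrite eqn_dvd -{1}IHn !order_dvdn.
apply/andP; split; apply/eqP.
  by apply: (next_frozen (M_next _)); rewrite ?IHn // (leq_trans lt_ik) ?leq_addl.
apply: (marked_tower_refineX (k := (n + k).+1)); rewrite ?expg_order //.
by rewrite ltnW ?ltnS ?leq_addl.
Qed.

Lemma marked_tower_periodic u : exists2 n, (0 < n)%N & forall k, meval (M k) u ^+ n = 1.
Proof.
have [i <-] := wordP u.
have [[k [lt_ik le_i]]|small] :=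
    pselect (exists k, (i < k)%N /\ (2 ^ i.+2 <= #[meval (M k) (word i)])%N).
  exists #[meval (M k) (word i)]; first exact: order_gt0.
  move=> l; have [le_kl|/ltnW le_lk] := leqP k l.
    by rewrite -(marked_tower_frozen lt_ik le_i le_kl) expg_order.
  by apply: marked_tower_refineX le_lk _; apply: expg_order.
(* If the threshold is never reached after stage [i], all later orders are below it and divide this
   factorial; the stages up to [i] follow by refinement. *)
exists (2 ^ i.+2)`!; first exact: fact_gt0.
have large k : (i < k)%N -> meval (M k) (word i) ^+ (2 ^ i.+2)`! = 1.
  move=> lt_ik; apply/eqP; rewrite -order_dvdn dvdn_fact // order_gt0 leqNgt.
  by apply/negP => /ltnW le_i; apply: small; exists k.
move=> k; have [le_ki|/large//] := leqP k i.
exact: marked_tower_refineX (leqW le_ki) (large _ (ltnSn i)).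
Qed.

Lemma limit_tower : is_tower (fun k (f : limit M) => limit_proj k f = 1).
Proof.
have prM k := @limit_projM M k; have evP := limit_evalP marked_tower_periodic.
split.
- move=> k; split=> [|x y x1 y1|x y x1]; first exact: morph_mul1 (prM k).
    by rewrite prM (morph_mulV (prM k)) x1 y1 invg1 mulg1.
  by rewrite (morph_mulJ (prM k)) x1 conj1g.
- by move=> f; have [u <-] := evP f; rewrite limit_proj_eval.
- move=> k f; have [u <-] := evP f; rewrite !limit_proj_eval.
  exact: marked_tower_refine1.
- move=> k f; have [u <-] := evP f; rewrite (morph_mulX (prM _)) !limit_proj_eval.
  exact: (next_exponent (M_next k)).
- move=> k f g; have [u <-] := evP f; have [v <-] := evP g.
  rewrite (morph_mulR (prM _)) !limit_proj_eval => u1 v1.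
  exact/eqP/commgP/(next_commute (M_next k)).
- move=> k; exists (M k), (@limit_proj M k) => f g fg.
  by rewrite prM (morph_mulV (prM k)) fg mulVg.
move=> f f1; apply: limit_proj_inj => k.
by rewrite f1 (morph_mul1 (prM k)).
Qed.

(** Choosing in each layer [k] an element [x k] outside the next one gives pairwise distinct
    elements. *)
Lemma limit_infinite : ~ finite_group (limit M).
Proof.
case/finite_seqP => s def_s.
have tN := limit_tower.
have /choice[x xP] k : exists f : limit M, limit_proj k f = 1 /\ limit_proj k.+1 f <> 1.
  have [u u1 u_neq1] := next_proper (M_next k).
  by exists (eval (@limit_gen M) u); rewrite !limit_proj_eval.
have x_neq j k : (j < k)%N -> x j <> x k.
  move=> lt_jk eq_x; case: (xP j) => _; apply; rewrite eq_x.
  exact: (tower_sub tN lt_jk (xP k).1).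
have x_inj : injective x.
  move=> j k eq_x; case: (ltngtP j k) => // /x_neq; first by case.
  by case; rewrite eq_x.
have : (size (map x (iota 0 (size s).+1)) <= size s)%N.
  apply: uniq_leq_size => [|f _]; first by rewrite (map_inj_uniq x_inj) iota_uniq.
  by have : [set` s]%classic f by rewrite -def_s.
by rewrite size_map size_iota ltnn.
Qed.

End MarkedTower.

(** * Assembly of the group *)

Lemma eval_finitely_generated (G : groupType) (a : bool -> G) :
  (forall g, exists u, eval a u = g) -> finitely_generated G.
Proof.
move=> aP; exists [:: a true; a false]; apply/seteqP; split=> // g _.
have [u <-] := aP g; elim: u => [|x u IHu].
  by rewrite /eval big_nil; apply: subgroup_generated1.
rewrite eval_cons -[eval a u]invgK; apply: subgroup_generatedF.
  apply: sub_gen_smallest.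
  have : a x \in [:: a true; a false] by case: x; rewrite !in_cons eqxx ?orbT.
  exact.
rewrite -[_^-1]mul1g; apply: subgroup_generatedF => //.
exact: subgroup_generated1.
Qed.

Theorem corollary1p3 :
  exists Q : groupType,
    [/\ finitely_generated Q, periodic Q & just_infinite Q] /\
    [/\ (* (1) *)
        forall (x : Q) (n : nat), is_order x n -> square_free n,
        (* (2) *)
        (forall S : groupType, is_section Q S -> residually_finite S) /\
        residually_finite Q
      & (* (3); up to isomorphism, a finite section is a finGroupType *)
        (forall S : finGroupType, is_section Q S ->
           (solvable [set: S])%g /\
           forall (p : nat) (P : {group S}), prime p ->
             (p.-Sylow([set: S]) P)%g -> (abelian P)%g) /\
        (forall S : groupType, is_section Q S ->
           nilpotent_group S -> abelian_group S)].
Proof.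
have [M [M_0 M_next]] := marked_tower_exists.
have perM := marked_tower_periodic M_next.
have fgL := eval_finitely_generated (limit_evalP perM).
have [N jiN] := just_infinite_quotient fgL (limit_infinite M_0 M_next).
have piM := @quot_piM _ N.
have pi_surj (y : quot N) : exists x, \pi_(quot N) x = y by elim/quotW: y => x; exists x.
have tQ : towered (quot N).
  apply: (towered_surj piM pi_surj); split; first exact: limit_torsion.
  by exists (fun k f => limit_proj k f = 1); apply: limit_tower.
have [torQ [T tT]] := tQ.
exists (quot N); split; split=> //.
- exact: finitely_generated_surj piM pi_surj fgL.
- move=> x; have [n n_gt0 xn] := torQ x.
  have ex_n : exists n, (0 < n)%N && (x ^+ n == 1) by exists n; rewrite n_gt0 xn eqxx.
  case: (ex_minnP ex_n) => m /andP[m_gt0 /eqP xm] min_m; exists m; split=> // k k_gt0 xk.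
  by apply: min_m; rewrite k_gt0 xk eqxx.
- by move=> x n; apply: tower_square_free tT.
- split=> [S secS|]; apply: towered_residually_finite => //.
  exact: towered_section secS.
split=> S /(towered_section tQ) tS; last exact: towered_nilpotent_abelian.
split; first exact: towered_solvable.
by move=> p P; apply: towered_Sylow_abelian.
Qed.
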